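(* Let $X$ be a Hausdorff topological vector space over $\mathbb{R}$ or $\mathbb{C}$, $A\subset X$ a convex set, $H$ a nonempty set of functions $X\to\overline{\mathbb{R}}$ closed under vertical shifts (i.e. $h+c\in H$ for all $h\in H$, $c\in\mathbb{R}$), and $f_i\colon X\to\mathbb{R}$, $i\in I_0=\{0\}\cup I$, $I=\{1,\ldots,n\}$. Let $\varphi_i\colon X\to\overline{\mathbb{R}}$ be weak upper $H$-convex approximations of the functions $f_i$ at a point $x^*\in A$ such that $\varphi_i(0)=0$, $i\in I_0$. Suppose that $x^*$ is a point of local minimum of the problem $$f_0(x)\to\inf,\quad x\in A,\quad f_i(x)\le0,\quad i\in I,$$ and that the $H$-convex function $$g(\cdot)=\sup\{\varphi_0(\cdot),\varphi_1(\cdot)+f_1(x^* ),\ldots,\varphi_n(\cdot)+f_n(x^* )\}$$ is subhomogeneous. Then $0$ is a point of global minimum of $g$ on the set $A-x^*$. Moreover, if $A=X$ and $0\in H$, then $0\in\underline{\partial}_Hg(0)$.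
   Context: $\overline{\mathbb{R}}=\mathbb{R}\cup\{\pm\infty\}$; for $f\colon X\to\overline{\mathbb{R}}$, $\operatorname{dom}f=\{x: f(x)\in\mathbb{R}\}$. A function $X\to\overline{\mathbb{R}}$ is $H$-convex if it is the pointwise supremum of a nonempty subset of $H$. $A-x^*=\{a-x^*\mid a\in A\}$. An $H$-convex function $\varphi\colon X\to\overline{\mathbb{R}}$ is a weak upper $H$-convex approximation of $f\colon X\to\mathbb{R}$ at $x$ if (1) $\varphi(0)\ge0$ and $0\in\operatorname{int}\operatorname{dom}\varphi$; (2) for every $\Delta x\in X$ there exist $\alpha_0>0$ and $\beta\colon(0,\alpha_0)\to\mathbb{R}$ such that $\operatorname{co}\{0,\alpha_0\Delta x\}\subset\operatorname{dom}\varphi$, $\beta(\alpha)\to0$ as $\alpha\downarrow0$, and $f(x+\alpha\Delta x)-f(x)\le\varphi(\alpha\Delta x)+\alpha\beta(\alpha)$ for all $\alpha\in(0,\alpha_0)$. A function $f\colon X\to\overline{\mathbb{R}}$ with $f(0)=0$ is subhomogeneous if $f(\alpha\Delta x)\le\alpha f(\Delta x)$ for all $\Delta x\in X$, $\alpha\in(0,1)$. $\underline{\partial}_Hg(0)=\{h\in H\mid h\le g \text{ on } X,\ h(0)=g(0)\}$ is the $H$-subdifferential of $g$ at $0$; $0\in\underline{\partial}_Hg(0)$ refers to the zero function. *)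

(* Defs.v *)
From HB Require Import structures.
From mathcomp Require Import all_boot all_order all_algebra.
From mathcomp Require Import complex.
From mathcomp Require Import all_classical all_reals all_analysis.

Set Implicit Arguments.
Unset Strict Implicit.
Unset Printing Implicit Defensive.

Import Order.TTheory GRing.Theory Num.Theory.
Import numFieldNormedType.Exports.

Local Open Scope classical_set_scope.
Local Open Scope ring_scope.

(* Vector spaces are over the reals or over the complex numbers, whereas step
   sizes and function values are always real; [of_real] embeds the former into
   the scalar field. *)
Variant scalars := RealScalars | ComplexScalars.

Definition scalar_field (R : realType) (k : scalars) : numFieldType :=
  match k with
  | RealScalars => R
  | ComplexScalars => R[i]%C
  end.

Definition of_real (R : realType) (k : scalars) : R -> scalar_field R k :=
  match k return R -> scalar_field R k with
  | RealScalars => fun t => t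
  | ComplexScalars => fun t => real_complex R t
  end.
Arguments of_real {R} k t.

Section AbstractConvexity.
Context (R : realType) (T : Type).
Implicit Types (H : set (T -> \bar R)) (f h : T -> \bar R).

Definition edom f : set T := [set x | f x \is a fin_num].

Definition closed_vertical_shift H : Prop :=
  forall h (c : R), H h -> H (fun x => (h x + c%:E)%E).

Definition Hconvex H f : Prop :=
  exists2 U : set (T -> \bar R), U `<=` H /\ U !=set0 &
    forall x, f x = ereal_sup [set h x | h in U].

Definition Hsubdiff H f (x : T) : set (T -> \bar R) :=
  [set h | [/\ H h, (forall y, (h y <= f y)%E) & h x = f x]].

Definition global_min_on f (S : set T) (x : T) : Prop :=
  S x /\ forall y, S y -> (f x <= f y)%E.

(* The elements [i != ord0] of ['I_n.+1] play the role of I = {1, ..., n}. *)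
Definition feasible (n : nat) (A : set T) (f : 'I_n.+1 -> T -> R) : set T :=
  [set x | A x /\ forall i, i != ord0 -> f i x <= 0].

(* sup{phi_0, phi_1 + f_1(xs), ..., phi_n + f_n(xs)} *)
Definition sup_approx (n : nat) (f : 'I_n.+1 -> T -> R)
    (phi : 'I_n.+1 -> T -> \bar R) (xs : T) (x : T) : \bar R :=
  (\big[maxe/phi ord0 x]_(i < n.+1 | i != ord0) (phi i x + (f i xs)%:E))%E.

Lemma Hconvex_shift H f (c : R) : closed_vertical_shift H -> Hconvex H f ->
  Hconvex H (fun x => (f x + c%:E)%E).
Proof.
move=> shH [U [UH [h0 Uh0]] fE].
exists [set (fun x => (h x + c%:E)%E) | h in U].
  split; first by move=> _ [h Uh <-]; apply: shH; exact: UH.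
  by exists (fun x => (h0 x + c%:E)%E), h0.
move=> x; rewrite fE; apply/eqP; rewrite eq_le; apply/andP; split.
  rewrite -leeBrDr//; apply: ge_ereal_sup => _ [h Uh <-].
  rewrite leeBrDr//; apply: ereal_sup_ubound.
  by exists (fun y => (h y + c%:E)%E) => //; exists h.
apply: ge_ereal_sup => _ [_ [h Uh <-] <-].
by rewrite leeD2r//; apply: ereal_sup_ubound; exists h.
Qed.

Lemma Hconvex_max H f g : Hconvex H f -> Hconvex H g ->
  Hconvex H (fun x => maxe (f x) (g x)).
Proof.
move=> [U [UH [h0 Uh0]] fE] [V [VH _] gE]; exists (U `|` V).
  by split; [move=> h [/UH|/VH]|exists h0; left].
move=> x; rewrite fE gE; apply/eqP; rewrite eq_le; apply/andP; split.
  rewrite ge_max; apply/andP; split; apply: ge_ereal_sup => _ [h Uh <-].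
    by apply: ereal_sup_ubound; exists h => //; left.
  by apply: ereal_sup_ubound; exists h => //; right.
apply: ge_ereal_sup => _ [h [Uh|Vh] <-]; rewrite le_max; apply/orP.
  by left; apply: ereal_sup_ubound; exists h.
by right; apply: ereal_sup_ubound; exists h.
Qed.

Lemma Hconvex_sup_approx H n (f : 'I_n.+1 -> T -> R)
    (phi : 'I_n.+1 -> T -> \bar R) (xs : T) :
  closed_vertical_shift H -> (forall i, Hconvex H (phi i)) ->
  Hconvex H (sup_approx f phi xs).
Proof.
move=> shH phiH; rewrite /sup_approx.
elim: (index_enum _) => [|i r IH].
  by rewrite (_ : (fun _ => _) = phi ord0)//; apply/funext => x; rewrite big_nil.
have [i0|i0] := boolP (i != ord0); last first.
  rewrite (_ : (fun _ => _) = fun x => \big[maxe/phi ord0 x]_(j <- r | j != ord0)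
    (phi j x + (f j xs)%:E)%E)//.
  by apply/funext => x; rewrite big_cons (negbTE i0).
rewrite (_ : (fun _ => _) = fun x => maxe (phi i x + (f i xs)%:E)%E
  (\big[maxe/phi ord0 x]_(j <- r | j != ord0) (phi j x + (f j xs)%:E)%E)).
  by apply: Hconvex_max => //; exact: Hconvex_shift.
by apply/funext => x; rewrite big_cons i0.
Qed.

End AbstractConvexity.

Section VectorSpace.
Context (R : realType) (k : scalars) (X : topologicalLmodType (scalar_field R k)).

Definition convex_hull (S : set X) : set X := smallest (@convex_set _ X) S.

Definition subhomogeneous (f : X -> \bar R) : Prop :=
  f 0 = 0%E /\
  forall (dx : X) (a : R), 0 < a < 1 -> (f (of_real k a *: dx) <= a%:E * f dx)%E.

(* Only the values of [beta] on ]0, a0[ are constrained. *)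
Definition weak_upper_Hconvex_approx (H : set (X -> \bar R))
    (phi : X -> \bar R) (f : X -> R) (x : X) : Prop :=
  [/\ Hconvex H phi,
      (0 <= phi 0%R)%E /\ (edom phi)° 0 &
      forall dx : X, exists (a0 : R) (beta : R -> R),
        [/\ 0 < a0,
            convex_hull [set 0; of_real k a0 *: dx] `<=` edom phi,
            beta a @[a --> 0^'+] --> 0 &
            forall a : R, 0 < a < a0 ->
              ((f (x + of_real k a *: dx) - f x)%:E
                 <= phi (of_real k a *: dx) + (a * beta a)%:E)%E]].

Definition local_min_problem (n : nat) (A : set X) (f : 'I_n.+1 -> X -> R)
    (xs : X) : Prop :=
  feasible A f xs /\
  \forall x \near xs, feasible A f x -> f ord0 xs <= f ord0 x.

End VectorSpace.

(* Main.v *)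
Require Import Defs.
From HB Require Import structures.
From mathcomp Require Import all_boot all_order all_algebra.
From mathcomp Require Import complex.
From mathcomp Require Import all_classical all_reals all_analysis.

Set Implicit Arguments.
Unset Strict Implicit.
Unset Printing Implicit Defensive.

Import Order.TTheory GRing.Theory Num.Theory.
Import numFieldNormedType.Exports.

Local Open Scope classical_set_scope.
Local Open Scope ring_scope.

(** If [g a < 0] for some direction [a] in [A - x*], then [g <= c < 0] there
    for a real [c], and subhomogeneity gives [g (t a) <= t c] for all small
    [t > 0].  The weak approximation inequalities turn this into
    [f_0 (x* + t a) - f_0 x* <= t (c + beta_0 t)] and
    [f_i (x* + t a) <= t (c + beta_i t)], whose right-hand sides are negative
    as soon as [t] is small.  By convexity of [A], the points [x* + t a] are then
    feasible, arbitrarily close to [x*] and strictly better than [x*]. *)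

Section RealScalarsEmbedding.
Context (R : realType) (k : scalars).

Lemma of_real_cvg0 :
  of_real k (t : R) @[t --> 0^'+] --> (0 : (scalar_field R k)^o).
Proof.
case: k => /=.
  by apply: cvg_within_filter; exact: cvg_id.
(* Being positive in the order of [R[i]] forces the radius to have zero imaginary part, so the bound
   reduces to a real one. *)
apply/(@cvgrPdist_lt _ R[i]^o) => -[e e'] /=; rewrite ltcE /= => /andP[/eqP e'0 e0].
rewrite e'0; near=> t.
rewrite sub0r normrN normc_def /= expr0n addr0 sqrtr_sqr ltcR.
by rewrite gtr0_norm//; near: t; exact: nbhs_right_lt.
Unshelve. all: by end_near. Qed.

Lemma of_real_itv (t : R) : 0 <= t <= 1 -> 0 <= of_real k t <= 1.
Proof. by case: k => //= /andP[t0 t1]; rewrite !lecR t0. Qed.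

End RealScalarsEmbedding.

Section Ray.
Context (R : realType) (k : scalars) (X : topologicalLmodType (scalar_field R k)).

(** Joint continuity of scaling at [(0, dx)] and of addition at [(x, 0)]; no norm on [X] is
    involved. *)
Lemma ray_cvg (x dx : X) : x + of_real k t *: dx @[t --> (0:R)^'+] --> x.
Proof.
rewrite -[X in _ --> X]addr0 -[X in _ + X](scale0r dx).
apply: (@cvg_comp _ _ _ (fun t : R => (x, of_real k t *: dx))
  (fun z : X * X => z.1 + z.2)); last exact: (add_continuous (x, 0 *: dx)).
apply: cvg_pair => /=; first exact: cvg_cst.
apply: (@cvg_comp _ _ _ (fun t : R => (of_real k t : (scalar_field R k)^o, dx))
  (fun z : (scalar_field R k)^o * X => z.1 *: z.2)); last first.
  exact: (scale_continuous (0, dx)).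
by apply: (@cvg_pair _ _ _ _ (nbhs (0 : (scalar_field R k)^o))) => /=; [exact: of_real_cvg0|exact: cvg_cst].
Qed.

Lemma convex_set_ray (A : set X) (x a : X) (t : R) :
  convex_set A -> A x -> A a -> 0 <= t <= 1 -> A (x + of_real k t *: (a - x)).
Proof.
move=> cA Ax Aa /(of_real_itv k) t01.
(* [convex_set] takes its coefficient in an interval type, so the bounds on [of_real k t] are packed
   into it. *)
have tI : Itv.spec (@Itv.num_sem (scalar_field R k))
    (Itv.Real `[0%Z, 1%Z]) (of_real k t).
  by apply/and3P; split; rewrite ?ger0_real ?in_itv//=; case/andP: t01.
have := cA a x (Itv.mk tI).
rewrite !inE => /(_ Aa Ax); congr A.
rewrite /conv /= scalerBl scale1r scalerBr.
by rewrite addrCA addrA addrC addrA.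
Qed.

(** The left-hand side is at most [t * (c + beta t)], negative once [beta t < - c]. As [r] is bound
    after [t], one range of [t] serves every shift: 0 for the objective, [f i xs] for a
    constraint. *)
Lemma weak_upper_Hconvex_approx_descent (H : set (X -> \bar R)) phi (f : X -> R)
    (x dx : X) (c : R) : weak_upper_Hconvex_approx H phi f x -> c < 0 ->
  \forall t \near 0^'+, forall r : R,
    (phi (of_real k t *: dx) + r%:E <= (t * c)%:E)%E ->
    f (x + of_real k t *: dx) - f x + r < 0.
Proof.
move=> [_ _ /(_ dx) [a0 [beta [a0_gt0 _ beta0 le_phi]]]] c0.
near=> t => r phir.
have t0 : 0 < t by [].
have ta : t < a0 by near: t; exact: nbhs_right_lt.
have bt : beta t < - c.
  by near: t; apply: (cvgr_lt 0) => //; rewrite oppr_gt0.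
have : (phi (of_real k t *: dx) <= (t * c - r)%:E)%E.
  by rewrite EFinB leeBrDr.
move=> /(leeD2r (t * beta t)%:E) /(le_trans (le_phi _ _)).
rewrite t0 ta -EFinD lee_fin => /(_ isT) le_f.
rewrite -(lerD2r r) in le_f.
apply: (le_lt_trans le_f).
rewrite addrAC subrK -mulrDr pmulr_rlt0// -ltrBrDl sub0r //.
Unshelve. all: by end_near. Qed.

End Ray.

Lemma sup_approx_leP (R : realType) (T : Type) n (f : 'I_n.+1 -> T -> R)
    (phi : 'I_n.+1 -> T -> \bar R) xs x (c : \bar R) :
  reflect ((phi ord0 x <= c)%E /\
           forall i, i != ord0 -> (phi i x + (f i xs)%:E <= c)%E)
    (sup_approx f phi xs x <= c)%E.
Proof. exact: bigmax_leP. Qed.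

Lemma lt0_ereal_le_EFin (R : realType) (y : \bar R) :
  (y < 0)%E -> exists2 c : R, c < 0 & (y <= c%:E)%E.
Proof.
case: y => [c| |] // y0; first by exists c.
by exists (-1); rewrite ?oppr_lt0 ?leNye.
Qed.

Theorem theorem5p2 (R : realType) (k : scalars)
    (X : topologicalLmodType (scalar_field R k)) (hausX : hausdorff_space X)
    (A : set X) (convA : convex_set A)
    (H : set (X -> \bar R)) (H0 : H !=set0) (shiftH : closed_vertical_shift H)
    (n : nat) (f : 'I_n.+1 -> X -> R) (phi : 'I_n.+1 -> X -> \bar R)
    (xs : X) (Axs : A xs)
    (approx : forall i, weak_upper_Hconvex_approx H (phi i) (f i) xs)
    (phi0 : forall i, phi i 0 = 0%E)
    (min_xs : local_min_problem A f xs)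
    (subhom : subhomogeneous (sup_approx f phi xs)) :
  global_min_on (sup_approx f phi xs) [set a - xs | a in A] 0 /\
  (A = setT -> H (fun=> 0%E) ->
   Hsubdiff H (sup_approx f phi xs) 0 (fun=> 0%E)).
Proof.
have g0 := subhom.1.
have gmin y : A y -> (0 <= sup_approx f phi xs (y - xs)%R)%E.
  move=> Ay; rewrite leNgt; apply/negP => /lt0_ereal_le_EFin[c c0 gc].
  have [_ mins] := min_xs.
  (* The filter [0^'+] is proper, so it is enough to refute all small [t]. *)
  suff : \forall t \near (0:R)^'+, False.
    by move=> /filter_ex[].
  have near_descent : \forall t \near (0:R)^'+, forall i (r : R),
      (phi i (of_real k t *: (y - xs)%R) + r%:E <= (t * c)%:E)%E ->
      f i (xs + of_real k t *: (y - xs)) - f i xs + r < 0.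
    (* Finitely many indices: the ranges of [t] intersect to a common one. *)
    apply: filter_forall => i.
    exact: (weak_upper_Hconvex_approx_descent (y - xs) (approx i) c0).
  have near_min := ray_cvg (y - xs) mins.
  near=> t.
  have t0 : 0 < t by [].
  have t1 : t < 1 by near: t; exact: nbhs_right_lt.
  have descent : forall i (r : R),
      (phi i (of_real k t *: (y - xs)%R) + r%:E <= (t * c)%:E)%E ->
      f i (xs + of_real k t *: (y - xs)) - f i xs + r < 0 by near: t.
  have minst : feasible A f (xs + of_real k t *: (y - xs)) ->
      f ord0 xs <= f ord0 (xs + of_real k t *: (y - xs)) by near: t.
  have /sup_approx_leP[phi0_le phi_le] :
      (sup_approx f phi xs (of_real k t *: (y - xs)%R) <= (t * c)%:E)%E.
    apply: (le_trans (subhom.2 _ _ _)); first by rewrite t0.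
    by rewrite EFinM lee_pmul2l.
  (* The objective strictly decreases, so only feasibility of the new point remains to be shown. *)
  have := descent ord0 0; rewrite adde0 addr0 subr_lt0 => /(_ phi0_le).
  rewrite ltNge minst//; split.
    by apply: convex_set_ray => //; rewrite !ltW.
  (* With shift [f i xs] the difference telescopes to [f i < 0] at the new point. *)
  by move=> i i0; have := descent i _ (phi_le i i0); rewrite subrK => /ltW.
split.
  split; first by exists xs; rewrite ?subrr.
  by move=> _ [a Aa <-]; rewrite g0; exact: gmin.
move=> AT H00; split; rewrite ?g0// => y.
by have := gmin (y + xs); rewrite addrK AT; apply.
Unshelve. all: by end_near. Qed.
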